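(* Consider words over the alphabet $\{\mathsf x,\mathsf y\}$. A history of length $n$ is a sequence $w_0=\mathsf x,w_1,\dots,w_n$ together with, for each $j<n$, a choice of a position in $w_j$, such that $w_{j+1}$ is obtained from $w_j$ by replacing the letter at the chosen position by $\mathsf y\mathsf y$ if it is $\mathsf x$ and by $\mathsf x\mathsf x$ if it is $\mathsf y$ (so there are exactly $n!$ histories of length $n$, and $w_n$ has $n+1$ letters). Let $H_{n,k}$ be the number of histories of length $n$ whose final word $w_n$ contains exactly $k$ occurrences of $\mathsf x$. Let $\operatorname{sm},\operatorname{cm}$ be the functions analytic near $0$ with $\operatorname{sm}'=\operatorname{cm}^2$, $\operatorname{cm}'=-\operatorname{sm}^2$, $\operatorname{sm}(0)=0$, $\operatorname{cm}(0)=1$, and set $\operatorname{smh}(z)=-\operatorname{sm}(-z)$, $\operatorname{cmh}(z)=\operatorname{cm}(-z)$. Then $$\sum_{n\ge0}H_{n,0}\frac{z^n}{n!}=\operatorname{smh}(z)=\frac{\operatorname{sm}(z)}{\operatorname{cm}(z)}=-\operatorname{sm}(-z),\qquad \sum_{n\ge0}H_{n,n+1}\frac{z^n}{n!}=\operatorname{cmh}(z)=\frac{1}{\operatorname{cm}(z)}=\operatorname{cm}(-z).$$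
   Context: This is the P\'olya urn with placement matrix $\begin{pmatrix}-1&2\\2&-1\end{pmatrix}$ started with one ball of type $\mathsf x$: $H_{n,0}$ counts histories ending with all balls of type $\mathsf y$, and $H_{n,n+1}$ those ending with all balls of type $\mathsf x$. Equivalently $\operatorname{smh},\operatorname{cmh}$ solve $x'=y^2$, $y'=x^2$, $x(0)=0$, $y(0)=1$. *)

(* Defs.v *)
From mathcomp Require Import all_boot.
From Stdlib Require Import Reals.
From Coquelicot Require Import Coquelicot.

Set Implicit Arguments.
Unset Strict Implicit.
Unset Printing Implicit Defensive.

Local Open Scope nat_scope.

Notation letter := bool (only parsing).
Definition lx : letter := true.
Definition ly : letter := false.

Definition word := seq letter.

Definition offspring (a : letter) : word :=
  if a == lx then [:: ly; ly] else [:: lx; lx].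

Definition replace_at (w : word) (i : nat) : word :=
  take i w ++ offspring (nth lx w i) ++ drop i.+1 w.

(* Candidates for a history of length n: words w_0, ..., w_n and 0-based
   positions p_0, ..., p_(n-1).  In a history w_j has j + 1 letters, so
   bounding all lengths by n + 1 and all positions by n loses nothing; it only
   makes the type finite, so that histories can be counted. *)
Definition prehistory (n : nat) : finType :=
  ({ffun 'I_n.+1 -> {bseq n.+1 of letter}} * {ffun 'I_n -> 'I_n.+1})%type.

Definition is_history (n : nat) (h : prehistory n) : bool :=
  let w (j : nat) : word := h.1 (inord j) in
  (w 0 == [:: lx]) &&
  [forall j : 'I_n,
     (h.2 j < size (w j)) && (w j.+1 == replace_at (w j) (h.2 j))].

Definition final_word (n : nat) (h : prehistory n) : word := h.1 ord_max.

Definition H (n k : nat) : nat :=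
  #|[set h : prehistory n | is_history h & count_mem lx (final_word h) == k]|.

(* [is_egf a f z]: the series sum_n a_n z^n / n! converges in C to f z. *)
Definition is_egf (a : nat -> nat) (f : C -> C) (z : C) : Prop :=
  is_pseries (K := C_AbsRing) (V := C_NormedModule)
    (fun n => RtoC (INR (a n) / INR n`!)) z (f z).

Definition analytic_near0 (f : C -> C) : Prop :=
  exists a : nat -> C,
    locally (RtoC 0) (fun z =>
      is_pseries (K := C_AbsRing) (V := C_NormedModule) a z (f z)).

(* sm and cm are germs at 0, represented by total functions on C whose values
   away from a neighbourhood of 0 are unconstrained. *)
Definition is_sm_cm (sm cm : C -> C) : Prop :=
  [/\ analytic_near0 sm /\ analytic_near0 cm,
      locally (RtoC 0) (fun z =>
        is_derive (K := C_AbsRing) (V := C_NormedModule) sm z (cm z ^ 2)%C),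
      locally (RtoC 0) (fun z =>
        is_derive (K := C_AbsRing) (V := C_NormedModule) cm z (- sm z ^ 2)%C),
      sm (RtoC 0) = RtoC 0 & cm (RtoC 0) = RtoC 1].

Definition smh (sm : C -> C) (z : C) : C := (- sm (- z))%C.
Definition cmh (cm : C -> C) (z : C) : C := cm (- z)%C.

(* Main.v *)
(* Along a curve with x' = y^2 and y' = x^2, differentiating the product of the
   letters of a word replaces in turn each factor x by y^2 and each factor y by
   x^2, so the n-th derivative of x is the sum of the monomials of the final words
   of all histories of length n.  At (x, y) = (0, 1) only words without x survive,
   at (1, 0) only words without y.  Both (smh, cmh) and (cmh, smh) are such curves
   on the real axis, and the coefficients of an analytic function are read off
   from the derivatives at 0 of its real and imaginary parts there.

   The identities cm(z) cm(-z) = 1 and sm(z) = - sm(-z) cm(z) follow from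
   uniqueness for linear differential equations along the segment [0, z]. *)

Require Import Defs.
From mathcomp Require Import all_boot.
From Stdlib Require Import Reals Lra.
From Coquelicot Require Import Coquelicot.

Set Implicit Arguments.
Unset Strict Implicit.
Unset Printing Implicit Defensive.

(** * Histories as sequences of positions *)

Local Open Scope nat_scope.

(** These are the position sequences with [p_j <= j], the bound coming from the [j + 1] letters of
    [w_j]. Since the words of a history are determined by its positions, counting over this list
    replaces counting over [prehistory], and its recursion peels off the last step. *)
Fixpoint choices (n : nat) : seq (seq nat) :=
  if n is m.+1 then [seq rcons p i | p <- choices m, i <- seq.iota 0 m.+1]
  else [:: [::]].

Lemma choicesSP m q :
  reflect (exists p i, [/\ p \in choices m, i <= m & q = rcons p i])
          (q \in choices m.+1).
Proof.
apply: (iffP allpairsP) => [[[p i] [p_m]]|[p [i [p_m le_i ->]]]].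
  by rewrite mem_iota => /= le_i ->; exists p, i.
by exists (p, i); split; rewrite ?mem_iota.
Qed.

Definition run (p : seq nat) : word := foldl replace_at [:: lx] p.

Definition positions n (h : prehistory n) : seq nat :=
  [seq (h.2 j : nat) | j <- enum 'I_n].

Lemma size_replace_at w i : i < size w -> size (replace_at w i) = (size w).+1.
Proof.
move=> lt_i; rewrite /replace_at !size_cat size_drop size_take lt_i.
have -> : size (offspring (nth lx w i)) = 2 by rewrite /offspring; case: ifP.
by rewrite addnCA add2n -addSn subnKC.
Qed.

Lemma choicesP n p :
  p \in choices n <-> size p = n /\ forall j, j < n -> nth 0 p j <= j.
Proof.
elim: n p => [|n IHn] p.
  by rewrite inE; split=> [/eqP-> //|[/size0nil-> _]].
split=> [/choicesSP[q [i [/IHn[szq leq] le_i ->]]]|[]].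
  split=> [|j]; first by rewrite size_rcons szq.
  rewrite ltnS leq_eqVlt nth_rcons szq => /predU1P[->|lt_j].
    by rewrite ltnn eqxx.
  by rewrite lt_j leq.
case/lastP: p => // q i; rewrite size_rcons => -[szq] lep.
apply/choicesSP; exists q, i; split=> //.
  apply/IHn; split=> // j lt_j.
  by have := lep j (ltnW lt_j); rewrite nth_rcons szq lt_j.
by have := lep n (ltnSn n); rewrite nth_rcons szq ltnn eqxx.
Qed.

Lemma uniq_choices n : uniq (choices n).
Proof.
elim: n => // n IHn; apply: (@allpairs_uniq _ _ _ (@rcons nat)) => //.
  exact: (iota_uniq 0 n.+1).
by move=> [p i] [q j] _ _ /rcons_inj[-> ->].
Qed.

Lemma take_choices n p j : j <= n -> p \in choices n -> take j p \in choices j.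
Proof.
move=> le_jn /choicesP[szp lep]; apply/choicesP.
split=> [|i lt_ij]; first by rewrite size_takel // szp.
by rewrite nth_take // lep // (leq_trans lt_ij).
Qed.

Lemma run_take p j : j < size p ->
  run (take j.+1 p) = replace_at (run (take j p)) (nth 0 p j).
Proof. by move=> lt_j; rewrite (take_nth 0) // /run foldl_rcons. Qed.

Lemma size_run n p : p \in choices n -> size (run p) = n.+1.
Proof.
elim: n p => [|n IHn] p; first by rewrite inE => /eqP->.
case/choicesSP=> q [i [/IHn szq le_i ->]].
by rewrite /run foldl_rcons size_replace_at -/(run q) szq.
Qed.

Lemma size_positions n (h : prehistory n) : size (positions h) = n.
Proof. by rewrite size_map size_enum_ord. Qed.

Lemma nth_positions n (h : prehistory n) (j : 'I_n) : nth 0 (positions h) j = h.2 j.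
Proof. by rewrite (nth_map j) ?size_enum_ord // nth_ord_enum. Qed.

(** The two claims are proved together by induction on prefixes: the bound on the next position
    needs the length of the current word, which is known once that word is a run of an admissible
    prefix. *)
Lemma history_words n (h : prehistory n) : is_history h ->
  positions h \in choices n /\
  forall j, j <= n -> h.1 (inord j) = run (take j (positions h)) :> word.
Proof.
case/andP=> /eqP w0 /forallP step.
suff IH j : j <= n -> take j (positions h) \in choices j /\
    h.1 (inord j) = run (take j (positions h)) :> word.
  split=> [|j /IH[]//].
  by have [] := IH _ (leqnn n); rewrite take_oversize ?size_positions.
elim: j => [|j IHj] lt_jn; first by rewrite take0 w0.
have [inj wj] := IHj (ltnW lt_jn).
have /andP[lt_p /eqP wS] := step (Ordinal lt_jn).
have jnth : nth 0 (positions h) j = h.2 (Ordinal lt_jn).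
  exact: (nth_positions h (Ordinal lt_jn)).
split; last by rewrite wS /= wj run_take ?size_positions // jnth.
rewrite (take_nth 0) ?size_positions //.
apply/choicesSP; exists (take j (positions h)), (nth 0 (positions h) j).
by split=> //; rewrite jnth -ltnS -(size_run inj) -wj.
Qed.

Lemma final_word_run n (h : prehistory n) : is_history h -> final_word h = run (positions h).
Proof.
case/history_words=> _ /(_ _ (leqnn n)).
rewrite take_oversize ?size_positions // => <-.
by rewrite /final_word; congr (bseqval (h.1 _)); apply/val_inj; rewrite /= inordK.
Qed.

Lemma positions_inj n : {in @is_history n &, injective (@positions n)}.
Proof.
move=> h h' /history_words[_ wh] /history_words[_ wh'] eqp.
have eq2 : h.2 = h'.2.
  by apply/ffunP=> j; apply/val_inj; rewrite /= -!nth_positions eqp.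
have eq1 : h.1 = h'.1.
  apply/ffunP=> j; apply/val_inj; have le_j : j <= n by rewrite -ltnS.
  by have := wh j le_j; rewrite eqp -(wh' j le_j) inord_val.
by case: h h' eq1 eq2 {wh wh' eqp} => [a b] [c d] /= -> ->.
Qed.

Lemma positions_surj n p : p \in choices n ->
  exists2 h : prehistory n, is_history h & positions h = p.
Proof.
move=> p_n; have [szp lep] := (@choicesP n p).1 p_n.
have szw j : j <= n -> size (run (take j p)) = j.+1.
  by move=> le_j; apply: (@size_run j); apply: (@take_choices n).
(* The default values of [insubd] and [inord] are never reached: the run of a prefix of length
   [j <= n] has [j + 1 <= n + 1] letters, and the positions are at most [n]. *)
pose h : prehistory n :=
  ([ffun j : 'I_n.+1 => insubd [bseq] (run (take j p))],
   [ffun j : 'I_n => inord (nth 0 p j)]).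
have h1 j : j <= n -> h.1 (inord j) = run (take j p) :> word.
  by move=> le_j; rewrite ffunE /= val_insubd inordK ?ltnS // szw // ltnS le_j.
have h2 (j : 'I_n) : h.2 j = nth 0 p j :> nat.
  by rewrite ffunE inordK // ltnS (leq_trans (lep _ (ltn_ord j))) // ltnW.
exists h; last first.
  apply: (@eq_from_nth _ 0) => [|j]; rewrite size_positions // => lt_j.
  by rewrite (nth_positions h (Ordinal lt_j)) h2.
rewrite /is_history h1 // take0 eqxx; apply/forallP=> j.
have le_j : j <= n := ltnW (ltn_ord j).
by rewrite !h1 // h2 szw // ltnS lep //= run_take ?szp.
Qed.

(** The map [positions] is a bijection from histories onto [choices n], and it carries the final
    word to [run]. *)
Lemma H_run n k : H n k = count (fun p => count_mem lx (run p) == k) (choices n).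
Proof.
pose hs := [seq h <- enum {: prehistory n} | is_history h].
have hsE h : (h \in hs) = is_history h by rewrite mem_filter mem_enum andbT.
have /permP <- : perm_eq [seq positions h | h <- hs] (choices n).
  apply: uniq_perm (uniq_choices n) _ => [|p].
    rewrite map_inj_in_uniq; first exact/filter_uniq/enum_uniq.
    by move=> h h'; rewrite !hsE; apply: positions_inj.
  apply/mapP/idP => [[h]|/positions_surj[h hh <-]].
    by rewrite hsE => /history_words[? _] ->.
  by exists h; rewrite ?hsE.
rewrite count_map /H cardsE cardE size_filter count_filter -enumT /=.
apply: eq_count => h /=; rewrite /in_mem /= andbC.
by case: (boolP (is_history h)) => [/final_word_run->|]; rewrite ?andbF ?andbT.
Qed.

(** * Complex-valued curves *)

Local Open Scope R_scope.

(** Differentiating by components makes the real tools, [Derive_n] and the mean value theorem,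
    available for complex values. *)
Definition curve_derive (f : R -> C) (t : R) (l : C) : Prop :=
  is_derive (fun t => Re (f t)) t (Re l) /\ is_derive (fun t => Im (f t)) t (Im l).

Lemma Im_le_Cmod (c : C) : Rabs (Im c) <= Cmod c.
Proof. exact: Rle_trans (Rmax_r _ _) (Rmax_Cmod c). Qed.

Lemma curve_derive_const (a : C) t : curve_derive (fun=> a) t 0.
Proof. by split; apply: is_derive_const. Qed.

Lemma curve_derive_plus f g t a b : curve_derive f t a -> curve_derive g t b ->
  curve_derive (fun t => f t + g t)%C t (a + b)%C.
Proof. by move=> [? ?] [? ?]; split; apply: is_derive_plus. Qed.

Lemma curve_derive_opp f t a : curve_derive f t a ->
  curve_derive (fun t => - f t)%C t (- a)%C.
Proof. by move=> [? ?]; split; apply: is_derive_opp. Qed.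

Lemma is_derive_value (f : R -> R) t a b : is_derive f t a -> a = b -> is_derive f t b.
Proof. by move=> ? <-. Qed.

Lemma curve_derive_mult f g t a b : curve_derive f t a -> curve_derive g t b ->
  curve_derive (fun t => f t * g t)%C t (a * g t + f t * b)%C.
Proof.
have comm (x y : R_AbsRing) : mult x y = mult y x by apply: Rmult_comm.
move=> [fr fi] [gr gi]; split.
  apply: (is_derive_value (is_derive_minus _ _ _ _ _
    (is_derive_mult _ _ _ _ _ fr gr comm) (is_derive_mult _ _ _ _ _ fi gi comm))).
   by rewrite /minus /plus /opp /mult /Re /Im /=; ring.
apply: (is_derive_value (is_derive_plus _ _ _ _ _
  (is_derive_mult _ _ _ _ _ fr gi comm) (is_derive_mult _ _ _ _ _ fi gr comm))).
by rewrite /plus /mult /Re /Im /=; ring.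
Qed.

Lemma curve_derive_ext f g t a b : (forall t, f t = g t) -> a = b ->
  curve_derive f t a -> curve_derive g t b.
Proof.
move=> eqfg <- [fr fi].
by split; [apply: is_derive_ext fr|apply: is_derive_ext fi] => x; rewrite eqfg.
Qed.

Lemma locally0_Cmod (P : C -> Prop) : locally (RtoC 0) P ->
  exists d : posreal, forall z, Cmod z < d -> P z.
Proof.
case/locally_C => d Pd; exists d => // z lt_z; apply: Pd.
by rewrite /ball /= /AbsRing_ball /abs /minus /plus /opp /= /Cminus Copp_0 Cplus_0_r.
Qed.

Lemma Cmod_locally0 (P : C -> Prop) (d : posreal) :
  (forall z, Cmod z < d -> P z) -> locally (RtoC 0) P.
Proof.
move=> Pd; apply/locally_C; exists d => z.
rewrite /ball /= /AbsRing_ball /abs /minus /plus /opp /= Copp_0 Cplus_0_r.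
exact: Pd.
Qed.

(** Chain rule along a ray: the first-order remainder of [f] is estimated in modulus, which bounds
    its real and imaginary parts. *)
Lemma is_derive_ray (f : C -> C) (z : C) (t : R) (l : C) :
  is_derive (K := C_AbsRing) (V := C_NormedModule) f (RtoC t * z)%C l ->
  curve_derive (fun t => f (RtoC t * z)%C) t (z * l)%C.
Proof.
case=> _ /(_ _ (fun _ P => P)) df.
pose D t' := (f (RtoC t' * z) - f (RtoC t * z) - RtoC (t' - t) * (z * l))%C.
have near_t (eps : posreal) : locally t (fun t' => Cmod (D t') <= eps * Rabs (t' - t)).
  have z0 := Cmod_ge_0 z.
  (* Dividing by [1 + Cmod z] rather than [Cmod z] also covers [z = 0]. *)
  have e1_gt0 : 0 < eps / (1 + Cmod z).
    by apply: Rdiv_lt_0_compat; [apply: cond_pos|lra].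
  have [d Hd] := df (mkposreal _ e1_gt0).
  have d1_gt0 : 0 < d / (1 + Cmod z).
    by apply: Rdiv_lt_0_compat; [apply: cond_pos|lra].
  exists (mkposreal _ d1_gt0) => t' Ht.
  have {}Ht : Rabs (t' - t) < d / (1 + Cmod z) by exact: Ht.
  have dz : (RtoC t' * z - RtoC t * z = RtoC (t' - t) * z)%C by rewrite RtoC_minus; ring.
  have dzn : Cmod (RtoC (t' - t) * z) = Rabs (t' - t) * Cmod z.
    by rewrite Cmod_mult Cmod_R.
  have Hb : Cmod (RtoC t' * z - RtoC t * z) < d.
    rewrite dz dzn.
    have := Rmult_lt_compat_r (1 + Cmod z) _ _ ltac:(lra) Ht.
    have -> : d / (1 + Cmod z) * (1 + Cmod z) = d by field; lra.
    have := Rabs_pos (t' - t); nra.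
  have := Hd _ Hb.
  rewrite /norm /= /minus /plus /opp /scal /mult /= /mult /=.
  rewrite -/(Cminus (RtoC t' * z) (RtoC t * z)) dz /abs /= dzn.
  have -> : (f (RtoC t' * z)%C + - f (RtoC t * z)%C + - (RtoC (t' - t) * z * l) = D t')%C.
    by rewrite /D; ring.
  move=> le_D; apply: Rle_trans le_D _.
  have := Rabs_pos (t' - t); have := cond_pos eps => e0 a0.
  have -> : eps / (1 + Cmod z) * (Rabs (t' - t) * Cmod z) =
    eps * Rabs (t' - t) * (Cmod z / (1 + Cmod z)) by field; lra.
  have : Cmod z / (1 + Cmod z) <= 1 by apply/Rle_div_l; lra.
  have : 0 <= eps * Rabs (t' - t) by nra.
  by nra.
have lin (a : R) : is_linear (fun y : R => scal y a) by apply: is_linear_scal_l.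
split; split=> // x /is_filter_lim_locally_unique <- eps.
  apply: filter_imp (near_t eps) => t'; apply: Rle_trans.
  apply: Rle_trans (re_le_Cmod _); right.
  rewrite /norm /= /abs /= /minus /plus /opp /scal /= /mult /= /D /Re /=; congr Rabs; ring.
apply: filter_imp (near_t eps) => t'; apply: Rle_trans.
apply: Rle_trans (Im_le_Cmod _); right.
rewrite /norm /= /abs /= /minus /plus /opp /scal /= /mult /= /D /Im /=; congr Rabs; ring.
Qed.

(** * The reflection identities *)

(* Gronwall: [N e^(-K t)] is nonincreasing. *)
Lemma gronwall0 (N dN : R -> R) (K T : R) : 0 <= T ->
  (forall t, 0 <= t <= T -> is_derive N t (dN t)) ->
  (forall t, 0 <= t <= T -> dN t <= K * N t) ->
  N 0 = 0 -> N T <= 0.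
Proof.
move=> T0 dNt leN N0.
pose g t := N t * exp (- K * t).
pose dg t := (dN t - K * N t) * exp (- K * t).
have dgt t : 0 <= t <= T -> is_derive g t (dg t).
  move=> /dNt Nt; rewrite /g /dg; auto_derive; first by exists (dN t).
  by rewrite (is_derive_unique _ _ _ Nt); ring.
(* The mean value theorem writes [g T - g 0] as [dg c * (T - 0)], and [dg c] is nonpositive. *)
have [||c []] := @MVT_gen g 0 T dg.
- by move=> x; rewrite Rmin_left ?Rmax_right; try lra; move=> ?; apply: dgt; lra.
- move=> x; rewrite Rmin_left ?Rmax_right; try lra; move=> ?.
  apply/continuity_pt_filterlim; apply: ex_derive_continuous.
  by exists (dg x); apply: dgt; lra.
rewrite Rmin_left ?Rmax_right; try lra; move=> c0T.
have -> : g 0 = 0 by rewrite /g N0; ring.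
rewrite /g /dg => eq1.
have := leN c c0T; have := exp_pos (- K * c); have := exp_pos (- K * T).
move=> eT ec leNc.
have : (dN c - K * N c) * exp (- K * c) <= 0 by nra.
by move=> ?; have : N T * exp (- K * T) <= 0; nra.
Qed.

(** The square of the modulus stays differentiable along curves that pass through 0, where [Cmod]
    itself may fail to be. *)
Definition sqnorm (z : C) : R := Re z * Re z + Im z * Im z.

Lemma sqnorm_Cmod z : sqnorm z = Cmod z * Cmod z.
Proof.
rewrite /Cmod sqrt_sqrt; first by rewrite /sqnorm /Re /Im /=; ring.
by have := Rle_0_sqr z.1; have := Rle_0_sqr z.2; rewrite /Rsqr /=; lra.
Qed.

Lemma sqnorm_le0 z : sqnorm z <= 0 -> z = RtoC 0.
Proof.
rewrite sqnorm_Cmod => le0; apply: Cmod_eq_0.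
by have := Cmod_ge_0 z; nra.
Qed.

Lemma sqnorm_derive f t a : curve_derive f t a ->
  is_derive (fun t => sqnorm (f t)) t (2 * Re (Cconj (f t) * a)).
Proof.
have comm (x y : R_AbsRing) : mult x y = mult y x by apply: Rmult_comm.
move=> [fr fi]; apply: (is_derive_value (is_derive_plus _ _ _ _ _
  (is_derive_mult _ _ _ _ _ fr fr comm) (is_derive_mult _ _ _ _ _ fi fi comm))).
by rewrite /plus /mult /Re /Im /=; ring.
Qed.

Lemma Re_conj_mult_le p a : Re (Cconj p * a) <= Cmod p * Cmod a.
Proof.
apply: Rle_trans (Rle_abs _) _; apply: Rle_trans (re_le_Cmod _) _.
by rewrite Cmod_mult Cmod_conj; right.
Qed.

(** Uniqueness for a homogeneous linear system, obtained by applying Gronwall to [|p|^2 + |q|^2]. *)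
Lemma linear_curves0 (p q dp dq : R -> C) (B T : R) : 0 <= B -> 0 <= T ->
  (forall t, 0 <= t <= T -> curve_derive p t (dp t)) ->
  (forall t, 0 <= t <= T -> curve_derive q t (dq t)) ->
  (forall t, 0 <= t <= T -> Cmod (dp t) <= B * (Cmod (p t) + Cmod (q t))) ->
  (forall t, 0 <= t <= T -> Cmod (dq t) <= B * (Cmod (p t) + Cmod (q t))) ->
  p 0 = RtoC 0 -> q 0 = RtoC 0 -> p T = RtoC 0 /\ q T = RtoC 0.
Proof.
move=> B0 T0 pt qt ldp ldq p0 q0.
pose N t := sqnorm (p t) + sqnorm (q t).
pose dN t := 2 * Re (Cconj (p t) * dp t) + 2 * Re (Cconj (q t) * dq t).
have : N T <= 0.
  (* The derivative of [N] is at most [2 B (|p| + |q|)^2], and [(|p| + |q|)^2 <= 2 (|p|^2 + |q|^2)];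
     hence the factor [4 * B]. *)
  apply: (@gronwall0 N dN (4 * B)) => //.
  - move=> t t0T; apply: is_derive_plus; apply: sqnorm_derive; auto.
  - move=> t t0T; rewrite /dN /N !sqnorm_Cmod.
    have := Re_conj_mult_le (p t) (dp t); have := Re_conj_mult_le (q t) (dq t).
    have := ldp t t0T; have := ldq t t0T.
    have := Cmod_ge_0 (p t); have := Cmod_ge_0 (q t).
    set P := Cmod (p t); set Q := Cmod (q t).
    set DP := Cmod (dp t); set DQ := Cmod (dq t) => Q0 P0 lq lp hq hp.
    have a1 : P * DP <= P * (B * (P + Q)) by apply: Rmult_le_compat_l.
    have a2 : Q * DQ <= Q * (B * (P + Q)) by apply: Rmult_le_compat_l.
    have a3 : 0 <= B * ((P - Q) * (P - Q)).
      by apply: Rmult_le_pos => //; apply: Rle_0_sqr.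
    by nra.
  by rewrite /N p0 q0 /sqnorm /=; ring.
rewrite /N; have := sqnorm_Cmod (p T); have := sqnorm_Cmod (q T) => e1 e2.
have := Rle_0_sqr (Cmod (p T)); have := Rle_0_sqr (Cmod (q T)); rewrite /Rsqr => ? ? ?.
by split; apply: sqnorm_le0; lra.
Qed.

Lemma Cminus_eq0 (a b : C) : (a - b = 0 -> a = b)%C.
Proof.
move=> ab0; have -> : (a = a - b + b)%C by ring.
by rewrite ab0; ring.
Qed.

(** Serves both equations of the system for the defects. The coefficients are at most
    [2 * (2 + 2 * 2) = 12] and [2 * 2 * 2 = 8]. *)
Lemma coef_bound (a b c d e f : C) (P Q : R) :
  Cmod a <= 2 -> Cmod b <= 2 -> Cmod c <= 2 -> Cmod d <= 2 -> Cmod e <= 2 ->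
  Cmod f <= 2 -> 0 <= P -> 0 <= Q ->
  Cmod a * Cmod (b - c * d) * Q + Cmod e * Cmod f * Cmod d * P <= 12 * (P + Q).
Proof.
move=> la lb lc ld le lf P0 Q0.
have mul2 x y k : 0 <= x <= 2 -> 0 <= y <= k -> 0 <= x * y <= 2 * k by move=> ? ?; nra.
have bd x : Cmod x <= 2 -> 0 <= Cmod x <= 2 by have := Cmod_ge_0 x.
have [bcd0 bcd] : 0 <= Cmod (b - c * d) <= 6.
  split; first exact: Cmod_ge_0.
  have := Cmod_triangle b (- (c * d)); rewrite Cmod_opp Cmod_mult.
  by have := mul2 _ _ 2 (bd c lc) (bd d ld); rewrite /Cminus; lra.
have h1 := mul2 _ _ 6 (bd a la) (conj bcd0 bcd).
have h2 := mul2 _ _ 4 (bd d ld) (mul2 _ _ 2 (bd e le) (bd f lf)).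
by rewrite (Rmult_comm _ (Cmod d)); nra.
Qed.

(* With s, c, u, v standing for sm(tz), cm(tz), sm(-tz), cm(-tz), the defects
   p = c v - 1 and q = s + u c satisfy the homogeneous linear system
     p' = - z (v (s - u c) q + u^2 c p),   q' = z (v^2 c p - u (s - u c) q),
   the second one because u^3 + v^3 = 1. *)
Lemma sm_cm_reflection (s c u v : R -> C) (z : C) :
  Cmod z <= 1 ->
  (forall t, 0 <= t <= 1 ->
    [/\ curve_derive s t (z * (c t * c t))%C,
        curve_derive c t (- (z * (s t * s t)))%C,
        curve_derive u t (- (z * (v t * v t)))%C &
        curve_derive v t (z * (u t * u t))%C]) ->
  (forall t, 0 <= t <= 1 ->
    [/\ Cmod (s t) <= 2, Cmod (c t) <= 2, Cmod (u t) <= 2 & Cmod (v t) <= 2]) ->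
  s 0 = RtoC 0 -> c 0 = RtoC 1 -> u 0 = RtoC 0 -> v 0 = RtoC 1 ->
  (c 1 * v 1 = 1)%C /\ (s 1 + u 1 * c 1 = 0)%C.
Proof.
move=> z1 curves bounds s0 c0 u0 v0.
(* A conserved quantity: the contributions [-3 z u^2 v^2] and [3 z u^2 v^2] to its derivative
   cancel. *)
have cubes t : 0 <= t <= 1 -> (u t * u t * u t + v t * v t * v t = 1)%C.
  move=> t01; pose r t := (u t * u t * u t + v t * v t * v t - 1)%C.
  have dr x : 0 <= x <= t -> curve_derive r x 0.
    move=> xt; have [_ _ du dv] := curves x ltac:(lra).
    have d3 := curve_derive_plus (curve_derive_plus
      (curve_derive_mult (curve_derive_mult du du) du)
      (curve_derive_mult (curve_derive_mult dv dv) dv)) (curve_derive_const (- (1)) x).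
    by apply: curve_derive_ext d3 => //=; ring.
  (* A curve with zero derivative is the case [B = 0], with the same curve in both places of the
     pair. *)
  have [||||||||r0 _] := @linear_curves0 r r (fun=> RtoC 0) (fun=> RtoC 0) 0 t;
    try lra; try assumption.
  - by move=> x _; rewrite Cmod_0; lra.
  - by move=> x _; rewrite Cmod_0; lra.
  - by rewrite /r u0 v0; ring.
  - by rewrite /r u0 v0; ring.
  by apply/Cminus_eq0.
pose p t := (c t * v t - 1)%C; pose q t := (s t + u t * c t)%C.
pose dp t := (- (z * (v t * (s t - u t * c t) * q t + u t * u t * c t * p t)))%C.
pose dq t := (z * (v t * v t * c t * p t - u t * (s t - u t * c t) * q t))%C.
have dpt t : 0 <= t <= 1 -> curve_derive p t (dp t).
  move=> t01; have [ds dc du dv] := curves t t01.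
  apply: curve_derive_ext (curve_derive_plus (curve_derive_mult dc dv)
    (curve_derive_const (- (1)) t)) => //.
  by rewrite /dp /p /q; ring.
have dqt t : 0 <= t <= 1 -> curve_derive q t (dq t).
  move=> t01; have [ds dc du dv] := curves t t01.
  apply: curve_derive_ext (curve_derive_plus ds (curve_derive_mult du dc)) => //.
  have /(f_equal (fun y => c t * c t * y)%C) := cubes t t01.
  rewrite /dq /p /q => e3.
  (* The factor 1 is made explicit in order to be replaced by [u^3 + v^3], which makes the
     right-hand side homogeneous in the defects. *)
  transitivity (z * (c t * c t * 1 - v t * v t * c t - u t * (s t * s t)))%C; first by ring.
  by rewrite -e3; ring.
have [||||||||p1 q1] := @linear_curves0 p q dp dq 12 1; try lra; try assumption.
- move=> t t01; have [ls lc lu lv] := bounds t t01.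
  rewrite /dp Cmod_opp Cmod_mult -[X in _ <= X]Rmult_1_l.
  apply: Rmult_le_compat => //; try exact: Cmod_ge_0.
  apply: Rle_trans (Cmod_triangle _ _) _; rewrite !Cmod_mult.
  by apply: coef_bound => //; exact: Cmod_ge_0.
- move=> t t01; have [ls lc lu lv] := bounds t t01.
  rewrite /dq Cmod_mult -[X in _ <= X]Rmult_1_l.
  apply: Rmult_le_compat => //; try exact: Cmod_ge_0.
  apply: Rle_trans (Cmod_triangle _ _) _; rewrite Cmod_opp !Cmod_mult.
  rewrite [X in X <= _]Rplus_comm.
  by apply: coef_bound => //; exact: Cmod_ge_0.
- by rewrite /p c0 v0; ring.
- by rewrite /q s0 u0; ring.
by split; [apply/Cminus_eq0; exact: p1|exact: q1].
Qed.

(** * Coefficients of power series *)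

Lemma fact_factorial n : Factorial.fact n = n`!.
Proof. by elim: n => //= n ->; rewrite factS. Qed.

(** At a real point the powers are real scalars, so a real-linear [pr] commutes with partial sums;
    the bound by [Cmod] carries it to the limit. It is applied to [Re] and [Im]. *)
Lemma pseries_proj (pr : C -> R) (a : nat -> C) (t : R) (l : C) :
  (forall x y, pr (x + y)%C = pr x + pr y) ->
  (forall (x : R) y, pr (RtoC x * y)%C = x * pr y) ->
  (forall x, Rabs (pr x) <= Cmod x) ->
  is_pseries (K := C_AbsRing) (V := C_NormedModule) a (RtoC t) l ->
  is_pseries (fun n => pr (a n)) t (pr l).
Proof.
move=> prD prZ le_pr.
have prB x y : pr (x - y)%C = pr x - pr y.
  have -> : (x - y = x + RtoC (-1) * y)%C by apply: injective_projections => /=; ring.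
  by rewrite prD prZ; ring.
rewrite /is_pseries /is_series => cv.
have pw k : pow_n (RtoC t : C_AbsRing) k = RtoC (pow_n (t : R_AbsRing) k).
  elim: k => //= k ->; rewrite /mult /= RtoC_mult //.
have sumE n : pr (sum_n (fun k => scal (pow_n (RtoC t : C_AbsRing) k) (a k : C_NormedModule)) n)
    = sum_n (fun k => scal (pow_n (t : R_AbsRing) k) (pr (a k))) n.
  elim: n => [|n IHn]; first by rewrite !sum_O pw /scal /= /mult /= prZ.
  by rewrite !sum_Sn prD IHn pw /scal /= /mult /= prZ.
apply: filterlim_ext sumE _.
apply: filterlim_comp cv _ => P [e Pe].
apply/locally_C; exists e => y ye; apply: Pe.
have {}ye : Cmod (y - l) < e by exact: ye.
have : Rabs (pr y - pr l) < e by rewrite -prB; apply: Rle_lt_trans ye; apply: le_pr.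
exact.
Qed.

Lemma pseries_Derive_n (g : R -> R) (b : nat -> R) :
  locally 0 (fun t => is_pseries b t (g t)) ->
  forall n, Derive_n g n 0 = b n * INR n`!.
Proof.
move=> [d gd] n.
(* The series converges at [d / 2], so its terms tend to 0 there, which is impossible outside the
   disk of convergence. *)
have rad : Rbar_lt 0 (CV_radius b).
  apply: (Rbar_lt_le_trans _ (d / 2)); first by have := cond_pos d => /=; lra.
  have -> : (d / 2 : R) = Rabs (d / 2) by rewrite Rabs_pos_eq //; have := cond_pos d; lra.
  apply/Rbar_not_lt_le => /CV_disk_outside; apply.
  apply: (is_lim_seq_ext (fun n => scal (pow_n (d / 2) n) (b n))).
    by move=> k; rewrite pow_n_pow /scal /= /mult /= Rmult_comm.
  apply: ex_series_lim_0; exists (g (d / 2)); apply: gd.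
  rewrite /ball /= /AbsRing_ball /abs /minus /plus /opp /= Ropp_0 Rplus_0_r Rabs_pos_eq;
  have := cond_pos d; lra.
rewrite -fact_factorial -Derive_n_coef //; apply: Derive_n_ext_loc.
by exists d => t /gd /is_pseries_unique.
Qed.

(** On the real axis the real and imaginary parts of [f] have the coefficients [Re (a n)] and
    [Im (a n)], each determined by derivatives at 0. *)
Lemma complex_pseries_coef (f : C -> C) (a : nat -> C) (d : nat -> nat) :
  locally (RtoC 0) (fun z =>
    is_pseries (K := C_AbsRing) (V := C_NormedModule) a z (f z)) ->
  (forall n, Derive_n (fun t => Re (f (RtoC t))) n 0 = INR (d n)) ->
  (forall n, Derive_n (fun t => Im (f (RtoC t))) n 0 = 0) ->
  forall n, a n = RtoC (INR (d n) / INR n`!).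
Proof.
move=> /locally0_Cmod [e fe] dRe dIm n.
have real_line (pr : C -> R) :
    (forall x y, pr (x + y)%C = pr x + pr y) ->
    (forall (x : R) y, pr (RtoC x * y)%C = x * pr y) ->
    (forall x, Rabs (pr x) <= Cmod x) ->
    Derive_n (fun t => pr (f (RtoC t))) n 0 = pr (a n) * INR n`!.
  move=> prD prZ le_pr; apply: (pseries_Derive_n (b := fun n => pr (a n))).
  exists e => t te; apply: pseries_proj => //; apply: fe.
  rewrite Cmod_R -[t]Rminus_0_r; exact: te.
have f0 : INR n`! <> 0 by rewrite -fact_factorial; apply: INR_fact_neq_0.
have eRe : INR (d n) = Re (a n) * INR n`!.
  rewrite -dRe; apply: real_line => [//|x y|]; last exact: re_le_Cmod.
  by rewrite /Re /=; ring.
have eIm : 0 = Im (a n) * INR n`!.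
  rewrite -[LHS](dIm n); apply: real_line => [//|x y|]; last exact: Im_le_Cmod.
  by rewrite /Im /=; ring.
have : Im (a n) = 0 by case: (Rmult_integral _ _ (esym eIm)).
rewrite eRe; case: (a n) => x y; rewrite /Re /Im /RtoC /= => ->.
by congr pair; field.
Qed.

(** * Derivatives along a curve as sums over histories *)

Definition sumC (s : seq C) : C := foldr Cplus 0%C s.

Lemma sumC_cat s1 s2 : sumC (s1 ++ s2) = (sumC s1 + sumC s2)%C.
Proof. by elim: s1 => [|x s1 /= ->]; rewrite ?Cplus_0_l ?Cplus_assoc. Qed.

Lemma sumC_scal (a : C) T (f : T -> C) (s : seq T) :
  sumC [seq (a * f x)%C | x <- s] = (a * sumC [seq f x | x <- s])%C.
Proof. by elim: s => /= [|x s ->]; [rewrite Cmult_0_r|rewrite Cmult_plus_distr_l]. Qed.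

Lemma sumC_allpairs T1 T2 T (f : T -> C) (g : T1 -> T2 -> T) s t :
  sumC [seq f z | z <- [seq g x y | x <- s, y <- t]] =
  sumC [seq sumC [seq f (g x y) | y <- t] | x <- s].
Proof. by elim: s => //= x s IHs; rewrite map_cat sumC_cat IHs -map_comp. Qed.

Lemma sumC_indicator T (b : pred T) (s : seq T) :
  sumC [seq (if b x then RtoC 1 else RtoC 0) | x <- s] = RtoC (INR (count b s)).
Proof.
elim: s => //= x s ->; rewrite plus_INR RtoC_plus.
by case: (b x).
Qed.

Lemma curve_derive_sumC T (f : T -> R -> C) (df : T -> C) t (s : seq T) :
  (forall x, curve_derive (f x) t (df x)) ->
  curve_derive (fun t => sumC [seq f x t | x <- s]) t (sumC [seq df x | x <- s]).
Proof.
move=> dfx; elim: s => /= [|x s IHs]; first exact: curve_derive_const.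
exact: curve_derive_plus.
Qed.

Definition weight (x y : C) (w : word) : C :=
  foldr (fun a m => ((if a then x else y) * m)%C) 1%C w.

Lemma weight_cat x y w1 w2 : weight x y (w1 ++ w2) = (weight x y w1 * weight x y w2)%C.
Proof. by elim: w1 => [|a w1 /= ->]; rewrite ?Cmult_1_l ?Cmult_assoc. Qed.

Lemma weight01 w : weight 0 1 w = if (count_mem lx w == 0)%nat then RtoC 1 else RtoC 0.
Proof.
elim: w => //= -[] w ->; first by rewrite Cmult_0_l.
by rewrite Cmult_1_l.
Qed.

Lemma weight10 w : weight 1 0 w = if count_mem lx w == size w then RtoC 1 else RtoC 0.
Proof.
elim: w => //= -[] w ->; first by rewrite Cmult_1_l.
rewrite Cmult_0_l add0n; case: eqP => // eq_sz.
by have := count_size (pred1 lx) w; rewrite eq_sz ltnn.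
Qed.

(* Replacing a letter of the word is differentiating the corresponding factor. *)
Lemma curve_derive_weight (x y : R -> C) t w :
  curve_derive x t (y t * y t)%C -> curve_derive y t (x t * x t)%C ->
  curve_derive (fun t => weight (x t) (y t) w) t
    (sumC [seq weight (x t) (y t) (replace_at w i) | i <- seq.iota 0 (size w)]).
Proof.
move=> dx dy; elim: w => [|a w IHw]; first exact: curve_derive_const.
have da : curve_derive (fun t => if a then x t else y t) t
    (weight (x t) (y t) (offspring a)).
  by case: a; [apply: curve_derive_ext dx|apply: curve_derive_ext dy] => //=;
    rewrite /weight /= Cmult_1_r.
apply: curve_derive_ext (curve_derive_mult da IHw) => //.
(* Position 0 gives the product-rule term of the first letter; the remaining positions, shifted by
   one, give that of the tail. *)
have -> : size (a :: w) = (1 + size w)%nat by [].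
rewrite iotaD map_cat sumC_cat -[(0 + 1)%nat]addn0.
rewrite iotaDl -map_comp -sumC_scal; congr (_ + _)%C.
by rewrite /= /replace_at /= drop0 weight_cat; ring.
Qed.

(** Along a curve with [x' = y^2] and [y' = x^2], this is the [n]-th derivative of [x]. *)
Definition history_poly n (x y : C) : C :=
  sumC [seq weight x y (run p) | p <- choices n].

Lemma curve_derive_history_poly (x y : R -> C) t n :
  curve_derive x t (y t * y t)%C -> curve_derive y t (x t * x t)%C ->
  curve_derive (fun t => history_poly n (x t) (y t)) t
    (history_poly n.+1 (x t) (y t)).
Proof.
move=> dx dy.
pose dw p := sumC [seq weight (x t) (y t) (replace_at (run p) i) |
  i <- seq.iota 0 (size (run p))].
apply: curve_derive_ext (curve_derive_sumC (choices n) (df := dw) _) => //; last first.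
  by move=> p; apply: curve_derive_weight.
rewrite /history_poly; transitivity (sumC [seq weight (x t) (y t) (run q) |
  q <- [seq rcons p i | p <- choices n, i <- seq.iota 0 n.+1]]) => //.
rewrite sumC_allpairs; congr sumC; apply/eq_in_map => p /size_run sz.
by rewrite /dw sz; congr sumC; apply: eq_map => i; rewrite /run foldl_rcons.
Qed.

Lemma history_poly01 n : history_poly n 0 1 = RtoC (INR (H n 0)).
Proof.
rewrite H_run -sumC_indicator /history_poly; congr sumC.
by apply: eq_map => p; rewrite weight01.
Qed.

Lemma history_poly10 n : history_poly n 1 0 = RtoC (INR (H n n.+1)).
Proof.
rewrite H_run -sumC_indicator /history_poly; congr sumC.
by apply/eq_in_map => p /size_run sz; rewrite weight10 sz.
Qed.

(** The induction ranges over all [t] in the interval because the next derivative needs the formula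
    on a whole neighbourhood of [t]. *)
Lemma Derive_n_history (x y : R -> C) (d : posreal) :
  (forall t, Rabs t < d -> curve_derive x t (y t * y t)%C) ->
  (forall t, Rabs t < d -> curve_derive y t (x t * x t)%C) ->
  forall n t, Rabs t < d ->
    Derive_n (fun t => Re (x t)) n t = Re (history_poly n (x t) (y t)) /\
    Derive_n (fun t => Im (x t)) n t = Im (history_poly n (x t) (y t)).
Proof.
move=> dx dy; elim=> [|n IHn] t td.
  have -> : history_poly 0 (x t) (y t) = x t by rewrite /history_poly /=; ring.
  by [].
have near_t : locally t (fun t => Rabs t < d).
  have e0 : 0 < d - Rabs t by lra.
  exists (mkposreal _ e0) => t' tt'; have {}tt' : Rabs (t' - t) < d - Rabs t by exact: tt'.
  by have := Rabs_triang_inv t' t; lra.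
have [dRe dIm] := curve_derive_history_poly n (dx t td) (dy t td).
split; rewrite /=.
  rewrite -(is_derive_unique _ _ _ dRe); apply: Derive_ext_loc.
  by apply: filter_imp near_t => t' /IHn[].
rewrite -(is_derive_unique _ _ _ dIm); apply: Derive_ext_loc.
by apply: filter_imp near_t => t' /IHn[].
Qed.

(** * Generating functions of analytic germs, and the final assembly *)

Lemma analytic_near0_opp f : analytic_near0 f -> analytic_near0 (fun z => - f z)%C.
Proof.
move=> [a fa]; exists (PS_opp (V := C_NormedModule) a).
by apply: filter_imp fa => z; apply: is_pseries_opp.
Qed.

Lemma analytic_near0_reflect f : analytic_near0 f -> analytic_near0 (fun z => f (- z)%C).
Proof.
move=> [a /locally0_Cmod [d fa]].
exists (fun n => (pow_n (RtoC (-1) : C_AbsRing) n * a n)%C).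
apply: (@Cmod_locally0 _ d) => z zd.
have := fa (- z)%C; rewrite Cmod_opp => /(_ zd); rewrite /is_pseries.
apply: is_series_ext => n.
have -> : pow_n ((- z)%C : C_AbsRing) n =
    (pow_n (z : C_AbsRing) n * pow_n (RtoC (-1) : C_AbsRing) n)%C.
  elim: n => [|n IHn] /=; first by rewrite /one /= Cmult_1_l.
  by rewrite IHn /mult /=; apply: injective_projections => /=; ring.
by rewrite /scal /= /mult /= Cmult_assoc.
Qed.

(** The history polynomials at the initial point fix the Taylor coefficients of [f]. Keeping [f] and
    [g] abstract lets [smh] and [cmh] exchange roles. *)
Lemma is_egf_of_history_curve (f g : C -> C) (h : nat -> nat) (d : posreal) :
  analytic_near0 f ->
  (forall t, Rabs t < d -> curve_derive (fun t => f (RtoC t)) t (g (RtoC t) * g (RtoC t))%C) ->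
  (forall t, Rabs t < d -> curve_derive (fun t => g (RtoC t)) t (f (RtoC t) * f (RtoC t))%C) ->
  (forall n, history_poly n (f 0) (g 0) = RtoC (INR (h n))) ->
  locally (RtoC 0) (is_egf h f).
Proof.
move=> [a fa] df dg hn.
have d0 : Rabs 0 < d by rewrite Rabs_R0; apply: cond_pos.
have dn n := Derive_n_history df dg n d0.
have coefs : forall n, a n = RtoC (INR (h n) / INR n`!).
  apply: (complex_pseries_coef fa) => n; have [eRe eIm] := dn n.
    by rewrite eRe hn.
  by rewrite eIm hn.
apply: filter_imp fa => z; rewrite /is_egf /is_pseries.
by apply: is_series_ext => n; rewrite coefs.
Qed.

(** By continuity [f] stays within 1 of [f 0]. This supplies the bounds by 2 in the reflection
    argument. *)
Lemma locally_bounded (f : C -> C) l : Cmod (f 0) <= 1 ->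
  is_derive (K := C_AbsRing) (V := C_NormedModule) f (RtoC 0) l ->
  locally (RtoC 0) (fun z => Cmod (f z) <= 2).
Proof.
move=> f0 df.
have cf : filterlim f (locally (RtoC 0 : C_AbsRing)) (locally (f 0)).
  by apply: (ex_derive_continuous (K := C_AbsRing) (V := C_NormedModule)); exists l.
have e1 : 0 < 1 by lra.
have : locally (f 0) (fun y => Cmod (y - f 0) < 1).
  by apply/locally_C; exists (mkposreal _ e1) => y; apply.
move=> /cf [d Hd]; apply: (@Cmod_locally0 _ d) => z zd.
have {Hd} zf : Cmod (f z - f 0) < 1.
  apply: Hd; rewrite /ball /= /AbsRing_ball /abs /minus /plus /opp /=.
  by rewrite Copp_0 Cplus_0_r.
have := Cmod_triangle (f z - f 0) (f 0).
have -> : (f z - f 0 + f 0 = f z)%C by ring.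
lra.
Qed.

Theorem mainTheorem3 (sm cm : C -> C) (hsc : is_sm_cm sm cm) :
  locally (RtoC 0) (fun z : C =>
    [/\ is_egf (fun n => H n 0) (smh sm) z,
        cm z <> RtoC 0,
        smh sm z = (sm z / cm z)%C &
        smh sm z = (- sm (- z))%C] /\
    [/\ is_egf (fun n => H n n.+1) (cmh cm) z,
        cmh cm z = (1 / cm z)%C &
        cmh cm z = cm (- z)%C]).
Proof.
have [[asm acm] dsm dcm sm0 cm0] := hsc.
have bsm := locally_bounded (l := (cm 0 ^ 2)%C) _ (locally_singleton _ _ dsm).
have bcm := locally_bounded (l := (- sm 0 ^ 2)%C) _ (locally_singleton _ _ dcm).
have {}bsm := bsm ltac:(by rewrite sm0 Cmod_0; lra).
have {}bcm := bcm ltac:(by rewrite cm0 Cmod_1; lra).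
have [d near0] :=
  locally0_Cmod (filter_and _ _ (filter_and _ _ dsm dcm) (filter_and _ _ bsm bcm)).
have ray_sm z t : Cmod (RtoC t * z) < d ->
    curve_derive (fun t => sm (RtoC t * z)%C) t
      (z * (cm (RtoC t * z)%C * cm (RtoC t * z)%C))%C.
  move=> /near0[[/is_derive_ray + _] _]; apply: curve_derive_ext => //=; ring.
have ray_cm z t : Cmod (RtoC t * z) < d ->
    curve_derive (fun t => cm (RtoC t * z)%C) t
      (- (z * (sm (RtoC t * z)%C * sm (RtoC t * z)%C)))%C.
  move=> /near0[[_ /is_derive_ray +] _]; apply: curve_derive_ext => //=; ring.
(* The ray through [-1] turns the derivatives of [sm] and [cm] into those of [smh] and [cmh] on the
   real axis. *)
have Nline t : (RtoC t * - (1) = - RtoC t)%C by ring.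
have smallN t : Rabs t < d -> Cmod (RtoC t * - (1)) < d.
  by rewrite Nline Cmod_opp Cmod_R.
have dsmh t : Rabs t < d -> curve_derive (fun t => smh sm (RtoC t)) t
    (cmh cm (RtoC t) * cmh cm (RtoC t))%C.
  move=> /smallN /ray_sm /curve_derive_opp; apply: curve_derive_ext.
    by move=> t'; rewrite Nline.
  by rewrite Nline /cmh; ring.
have dcmh t : Rabs t < d -> curve_derive (fun t => cmh cm (RtoC t)) t
    (smh sm (RtoC t) * smh sm (RtoC t))%C.
  move=> /smallN /ray_cm; apply: curve_derive_ext.
    by move=> t'; rewrite Nline.
  by rewrite Nline /smh; ring.
have opp0 : (- RtoC 0 = RtoC 0)%C by ring.
have smh0 : smh sm 0 = RtoC 0 by rewrite /smh opp0 sm0 opp0.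
have cmh0 : cmh cm 0 = RtoC 1 by rewrite /cmh opp0 cm0.
have egf_smh : locally (RtoC 0) (is_egf (fun n => H n 0) (smh sm)).
  apply: is_egf_of_history_curve dsmh dcmh _.
    exact/analytic_near0_opp/analytic_near0_reflect.
  by move=> n; rewrite smh0 cmh0 history_poly01.
(* The same system with the two curves exchanged, hence started at [(1, 0)]. *)
have egf_cmh : locally (RtoC 0) (is_egf (fun n => H n n.+1) (cmh cm)).
  apply: is_egf_of_history_curve dcmh dsmh _.
    exact/analytic_near0_reflect.
  by move=> n; rewrite smh0 cmh0 history_poly10.
have reflection z : Cmod z < d -> Cmod z <= 1 ->
    (cm z * cm (- z) = 1)%C /\ (sm z + sm (- z) * cm z = 0)%C.
  move=> zd z1.
  have tz t : 0 <= t <= 1 -> Cmod (RtoC t * z) < d.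
    move=> [t0 t1]; rewrite Cmod_mult Cmod_R Rabs_pos_eq //.
    by have := Cmod_ge_0 z; nra.
  have tNz t : 0 <= t <= 1 -> Cmod (RtoC t * - z) < d.
    by move=> /tz; rewrite !Cmod_mult Cmod_opp.
  have := @sm_cm_reflection (fun t => sm (RtoC t * z)%C) (fun t => cm (RtoC t * z)%C)
    (fun t => sm (RtoC t * - z)%C) (fun t => cm (RtoC t * - z)%C) z z1.
  rewrite !Cmult_1_l !Cmult_0_l; apply=> // t t01; split=> //.
  - exact/ray_sm/tz.
  - exact/ray_cm/tz.
  - by apply: curve_derive_ext (ray_sm _ _ (tNz t t01)) => //; ring.
  - by apply: curve_derive_ext (ray_cm _ _ (tNz t t01)) => //; ring.
  - by case: (near0 _ (tz t t01)) => _ [].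
  - by case: (near0 _ (tz t t01)) => _ [].
  - by case: (near0 _ (tNz t t01)) => _ [].
  - by case: (near0 _ (tNz t t01)) => _ [].
(* The radius is also cut to 1 because [sm_cm_reflection] assumes [Cmod z <= 1]. *)
have [d1 d1d d11] : exists2 d1 : posreal, d1 <= d & d1 <= 1.
  have m0 : 0 < Rmin d 1 by apply: Rmin_glb_lt; [apply: cond_pos|lra].
  by exists (mkposreal _ m0); [apply: Rmin_l|apply: Rmin_r].
have small : locally (RtoC 0) (fun z => Cmod z < d1).
  by apply: (@Cmod_locally0 _ d1).
apply: filter_imp (filter_and _ _ (filter_and _ _ egf_smh egf_cmh) small).
move=> z [[esm ecm] zd1].
have [cv1 suc0] := reflection z ltac:(lra) ltac:(lra).
have cmz : cm z <> RtoC 0.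
  by move=> cz0; move: cv1; rewrite cz0 Cmult_0_l => /(f_equal Re) /= ?; lra.
split; split=> //.
  have -> : sm z = (- (sm (- z) * cm z))%C.
    by apply: Cminus_eq0; rewrite -suc0; ring.
  by rewrite /smh; field.
by rewrite -cv1 /cmh; field.
Qed.
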